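(* Let $M$ be a linear subspace of an extended locally convex space $(X,\tau)$. Then the following statements are equivalent. (1) $M$ is a barreled subspace of $X$. (2) $M\cap X_{fin}^\rho$ is a barreled subspace of $X$ for every continuous extended seminorm $\rho$ on $X$. (3) $M\cap X_{fin}^\rho$ is a barreled subspace of $X$ for some continuous extended seminorm $\rho$ on $X$.
   Context: Vector spaces are over $\mathbb{K}\in\{\mathbb{R},\mathbb{C}\}$. An extended seminorm on a vector space $X$ is a map $\rho:X\to[0,\infty]$ with $\rho(\alpha x)=|\alpha|\rho(x)$ (convention $0\cdot\infty=0$) and $\rho(x+y)\le\rho(x)+\rho(y)$. An extended locally convex space (elcs) is a vector space $X$ with a Hausdorff topology $\tau$ induced by a family $\mathcal{P}$ of extended seminorms, i.e. the sets $\{y\in X:\rho(y-x)<\epsilon\}$ ($\rho\in\mathcal{P}$, $x\in X$, $\epsilon>0$) form a subbase of $\tau$. An extended seminorm $\rho$ is continuous on an elcs iff $\{x:\rho(x)<\epsilon\}$ is a neighborhood of $0$ for every $\epsilon>0$. For an extended seminorm $\rho$ on $X$, $X_{fin}^\rho=\{x\in X:\rho(x)<\infty\}$. A barrel in an elcs is a closed, absolutely convex (balanced and convex), absorbing subset; an elcs is barreled if every barrel in it is a neighborhood of $0$. A subspace $Y$ of an elcs $(X,\tau)$ is a barreled subspace if $(Y,\tau|_Y)$ is barreled, where $\tau|_Y$ is the subspace topology. *)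

(* Defs.v *)
From HB Require Import structures.
From mathcomp Require Import all_boot all_order all_algebra.
From mathcomp Require Import complex.
From mathcomp Require Import all_classical all_reals all_analysis.

Set Implicit Arguments.
Unset Strict Implicit.
Unset Printing Implicit Defensive.

Import Order.TTheory GRing.Theory Num.Theory.

Local Open Scope classical_set_scope.
Local Open Scope ring_scope.

Inductive scalars := RealScalars | ComplexScalars.

Definition scalar_field (R : realType) (k : scalars) : numFieldType :=
  match k with RealScalars => R | ComplexScalars => R[i] end.

(* The absolute value of [scalar_field R k] with values in [R]: for complex
   scalars, the library norm [`|z|] lives in [R[i]] (with zero imaginary part),
   so its real part is taken. *)
Definition modulus (R : realType) (k : scalars) : scalar_field R k -> R :=
  match k return scalar_field R k -> R with
  | RealScalars => fun a : R => `|a|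
  | ComplexScalars => fun a : R[i] => complex.Re `|a|
  end.

Section Subspace.
Context (K : numFieldType) (X : preTopologicalLmodType K).

Definition linear_subspace (M : set X) : Prop := submod_closed [in M].

(* A linear subspace as a type of its own, with the induced vector space
   structure and the subspace topology. *)
Definition sub_lmod (M : set X) (_ : linear_subspace M) : Type := set_type M.

Variables (M : set X) (linM : linear_subspace M).

HB.instance Definition _ := SubChoice.copy (sub_lmod linM) (set_type M).

HB.instance Definition _ := GRing.SubChoice_isSubLmodule.Build K X [in M]
  (sub_lmod linM) (GRing.submod_closed_semi linM).

HB.instance Definition _ := Topological.copy (sub_lmod linM)
  (initial_topology (val : sub_lmod linM -> X)).

End Subspace.

Section Barrel.
Context (K : numFieldType) (X : preTopologicalLmodType K).

Definition balanced (B : set X) : Prop :=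
  forall a : K, `|a| <= 1 -> [set a *: x | x in B] `<=` B.

(* For complex scalars, [0 < r] in [R[i]] forces [r] to be a positive real. *)
Definition absorbing (B : set X) : Prop :=
  forall x : X, exists2 r : K, 0 < r &
    forall a : K, r <= `|a| -> [set a *: y | y in B] x.

Definition absolutely_convex (B : set X) : Prop :=
  balanced B /\ convex_set (B : set (convex_lmodType X)).

Definition barrel (B : set X) : Prop :=
  [/\ closed B, absolutely_convex B & absorbing B].

Definition barreled : Prop :=
  forall B : set X, barrel B -> nbhs (0 : X) B.

End Barrel.

Arguments barreled {K} X.

Definition barreled_subspace (K : numFieldType) (X : preTopologicalLmodType K)
    (M : set X) : Prop :=
  exists linM : linear_subspace M, barreled (sub_lmod linM).

Definition subbase (T : topologicalType) (S : set (set T)) : Prop :=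
  basis (finI_from S id).

Section Elcs.
Context (R : realType) (k : scalars).
Context (X : preTopologicalLmodType (scalar_field R k)).

(* The convention [0 * +oo = 0] is the one of [\bar R]. *)
Definition extended_seminorm (rho : X -> \bar R) : Prop :=
  [/\ forall x, (0 <= rho x)%E,
      forall (a : scalar_field R k) x, rho (a *: x) = ((modulus a)%:E * rho x)%E
    & forall x y, (rho (x + y)%R <= rho x + rho y)%E].

(* The vector space and the topology of [X] are not assumed compatible in any
   other way: scalar multiplication need not be continuous in an elcs. *)
Definition elcs : Prop :=
  hausdorff_space X /\
  exists2 P : set (X -> \bar R),
    (forall rho, P rho -> extended_seminorm rho) &
    subbase [set U : set X | exists rho x (e : R),
      [/\ P rho, 0 < e & U = [set y | (rho (y - x)%R < e%:E)%E]]].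

Definition continuous_extended_seminorm (rho : X -> \bar R) : Prop :=
  extended_seminorm rho /\
  forall e : R, 0 < e -> nbhs (0 : X) [set x | (rho x < e%:E)%E].

Definition fin_part (rho : X -> \bar R) : set X := [set x | (rho x < +oo)%E].

End Elcs.

Arguments elcs {R k} X.

(* Main.v *)
Require Import Defs.
From HB Require Import structures.
From mathcomp Require Import all_boot all_order all_algebra.
From mathcomp Require Import complex.
From mathcomp Require Import all_classical all_reals all_analysis.

(** Let [N = M `&` fin_part rho], which is open in [M].  If [N] is barreled and
    [B] is a barrel of [M], then [B `&` N] is a barrel of [N], so [B] contains a
    neighborhood of [0] in [N], hence in [M].  Conversely let [M] be barreled and
    [B] a barrel of [N].  For an algebraic complement [W] of [N] in [M] the set
    [B + W] is absorbing in [M]; it is closed in [M] because each coset of [N] is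
    open in [M] and [B + W] meets [N + w] in the translate [B + w].  So [B + W]
    is a barrel of [M], and [B] is its intersection with [N]. *)

Local Open Scope classical_set_scope.

Import Order.TTheory GRing.Theory Num.Theory.
Local Open Scope ring_scope.

(** * Linear subspaces as sets, and algebraic complements *)

Lemma submod_closed_setP {K : pzRingType} {X : lmodType K} (M : set X) :
  submod_closed [in M] <->
  M 0 /\ forall a x y, M x -> M y -> M (a *: x + y).
Proof.
split=> -[M0 MD]; split; first by move: M0; rewrite unfold_in/= in_setE.
- move=> a x y Mx My; have := MD a x y.
  by rewrite !unfold_in/= !in_setE; exact.
- by rewrite unfold_in/= in_setE.
- by move=> a x y; rewrite !unfold_in/= !in_setE; exact: MD.
Qed.

Lemma submod_closed_setZ {K : pzRingType} {X : lmodType K} (M : set X) a x :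
  submod_closed [in M] -> M x -> M (a *: x).
Proof.
by move=> /submod_closed_setP[M0 MD] Mx; rewrite -[_ *: _]addr0; exact: MD.
Qed.

Lemma submod_closed_setD {K : pzRingType} {X : lmodType K} (M : set X) x y :
  submod_closed [in M] -> M x -> M y -> M (x + y).
Proof.
by move=> /submod_closed_setP[_ MD] Mx My; rewrite -[x]scale1r; exact: MD.
Qed.

Lemma submod_closed_setB {K : pzRingType} {X : lmodType K} (M : set X) x y :
  submod_closed [in M] -> M x -> M y -> M (x - y).
Proof.
move=> linM Mx My; apply: submod_closed_setD => //.
by rewrite -scaleN1r; exact: submod_closed_setZ.
Qed.

(** Zorn's lemma gives a maximal subspace [W] of [M] meeting [N] trivially; a point of [M] outside
    [N + W] could be adjoined to it. *)
Lemma exists_complement {K : fieldType} {X : lmodType K} (M N : set X) :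
  submod_closed [in M] -> submod_closed [in N] ->
  exists W : set X, [/\ submod_closed [in W], W `<=` M, N `&` W `<=` [set 0] &
    forall x, M x -> exists2 w, W w & N (x - w)].
Proof.
move=> /submod_closed_setP[M0 MD] linN.
have [N0 _] := (submod_closed_setP _).1 linN.
(* [W 0] is left out so that the union of the empty chain satisfies [P]. *)
pose P (W : set X) := [/\ forall a x y, W x -> W y -> W (a *: x + y),
  W `<=` M & N `&` W `<=` [set 0]].
have [|W [[WD WM NW0] Wmax]] := @Zorn_bigcup _ P.
  move=> F FP Ftot; split.
  - move=> a x y [A FA Ax] [B FB By].
    have [AB|BA] := Ftot _ _ FA FB.
    + by exists B => //; have [BD _ _] := FP _ FB; apply: BD => //; exact: AB.
    + by exists A => //; have [AD _ _] := FP _ FA; apply: AD => //; exact: BA.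
  - by move=> x [A FA Ax]; have [_ + _] := FP _ FA; exact.
  - by move=> x [Nx [A FA Ax]]; have [_ _] := FP _ FA; exact.
(* Any [x] in [W] yields [- x + x = 0] in [W], so without [0] the set [W] is empty and [[set 0]] is
   strictly larger. *)
have W0 : W 0.
  apply: contrapT => nW0; apply: (Wmax [set 0]).
    split=> [x Wx|E]; last by apply: nW0; exact: E.
    by exfalso; apply: nW0; rewrite -(addNr x) -scaleN1r; exact: WD.
  split=> [a x y -> ->|x ->//|x []//].
  by rewrite scaler0 addr0.
have linW : submod_closed [in W] by exact: (submod_closed_setP W).2 (conj W0 WD).
exists W; split => //.
move=> x Mx; apply: contrapT => xNW.
apply: (Wmax [set z | exists a, exists2 w, W w & z = a *: x + w]).
  split=> [w Ww|E]; first by exists 0, w => //; rewrite scale0r add0r.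
  apply: xNW; exists x; last by rewrite subrr.
  by apply: E; exists 1, 0; rewrite // scale1r addr0.
split.
- move=> c _ _ [a [v Wv ->]] [b [w Ww ->]].
  exists (c * a + b), (c *: v + w); first exact: WD.
  by rewrite scalerDr scalerA addrACA scalerDl.
- by move=> _ [a [w Ww ->]]; apply: MD => //; exact: WM.
- move=> z [Nz [a [w Ww zE]]]; rewrite {z}zE in Nz *; move: Nz.
  (* If [a] is nonzero, dividing [a *: x + w] by [a] puts [x + a^-1 *: w] in [N], hence [x] in
     [N + W]. *)
  have [->|a0] := eqVneq a 0.
    by rewrite scale0r add0r => Nw; exact: NW0.
  move=> Nz; exfalso; apply: xNW; exists (- a^-1 *: w).
    exact: submod_closed_setZ.
  rewrite scaleNr opprK -[X in X + _]scale1r -(mulVf a0) -scalerA -scalerDr.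
  exact: submod_closed_setZ.
Qed.

(** * Barrels of a subspace, read in the ambient space *)

Section TraceBarrel.
Context {K : numFieldType} {X : preTopologicalLmodType K}.
Implicit Types (M B : set X).

(* The barrels of the subspace [M], as subsets of the ambient space [X]. *)
Definition trace_barrel M B : Prop :=
  [/\ exists2 C, closed C & B = M `&` C, absolutely_convex B &
    forall x, M x -> exists2 r : K, 0 < r &
      forall a : K, r <= `|a| -> [set a *: y | y in B] x].

Section SubLmod.
Variables (M : set X) (linM : linear_subspace M).
Implicit Types x : sub_lmod linM.

Lemma val0 : \val (0 : sub_lmod linM) = 0.
Proof. by []. Qed.

Lemma valZ a x : \val (a *: x) = a *: \val x.
Proof. by []. Qed.

End SubLmod.

(** Closed sets and neighborhoods of [0] in the initial topology are traces on [M] of those of [X],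
    so barrels pass through [val] both ways. This allows different subspaces to be compared inside
    [X]. *)
Lemma barreled_subspaceP M : linear_subspace M ->
  barreled_subspace M <->
  (forall B, trace_barrel M B -> exists2 U, nbhs 0 U & M `&` U `<=` B).
Proof.
move=> linM0; split.
- move=> [linM barM] B [[C cC BE] [balB cvxB] absB].
  have inM x : M x -> exists z : sub_lmod linM, val z = x.
    by move=> Mx; exists (Sub x (mem_set Mx)); rewrite SubK.
  have /barM : barrel (val @^-1` B : set (sub_lmod linM)).
    split.
    + have -> : val @^-1` B = val @^-1` C :> set (sub_lmod linM).
        rewrite BE; apply/seteqP; split=> [z []//|z Cz]; split=> //.
        exact: set_mem (valP z).
      apply: closed_comp cC => z _; exact: initial_continuous.
    + split.
      * move=> a a1 _ [z Bz <-]; rewrite /preimage/mkset valZ.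
        by apply: balB a1 _ _; exists (val z).
      * move=> x y l; rewrite !in_setE /= => Bx By.
        have := cvxB (val x) (val y) l; rewrite !in_setE; exact.
    + move=> x; have [r r0 rB] := absB _ (set_mem (valP x)).
      exists r => // a /rB[y By xE].
      have [z zE] : exists z : sub_lmod linM, val z = y.
        by apply: inM; move: By; rewrite BE => -[].
      exists z; first by rewrite /= zE.
      by apply: val_inj; rewrite valZ zE.
  rewrite nbhsE => -[_ [[U oU <-] U0] UB].
  exists U; first by apply: open_nbhs_nbhs; split=> //; rewrite -(val0 linM).
  by move=> _ [/inM[z <-] Uz]; exact: UB.
- move=> barM; exists linM0 => B [clB [balB cvxB] absB].
  have [|U U0 UB] := barM (val @` B).
    split.
    + move: clB; rewrite -openC => -[U oU UB].
      exists (~` U); first exact: open_closedC.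
      rewrite -[B]setCK -UB; apply/seteqP; split.
        by move=> _ [z nUz <-]; split=> //; exact: set_mem (valP z).
      move=> x [Mx nUx]; exists (Sub x (mem_set Mx)) => //.
    + split.
      * move=> a a1 _ [_ [z Bz <-] <-]; exists (a *: z) => //.
        by apply: (balB a a1); exists z.
      * move=> _ _ l /set_mem[x Bx <-] /set_mem[y By <-]; apply/mem_set.
        exists (conv l (x : convex_lmodType (sub_lmod linM0)) y) => //.
        exact: (set_mem (cvxB x y l (mem_set Bx) (mem_set By))).
    + move=> x Mx; have [r r0 rB] := absB (Sub x (mem_set Mx)).
      exists r => // a /rB[y By yE]; exists (val y); first by exists y.
      by rewrite -valZ yE SubK.
  have U0' : nbhs (0 : sub_lmod linM0) (val @^-1` U).
    exact: (@initial_continuous _ _ (val : sub_lmod linM0 -> X) 0 U).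
  apply: filterS U0' => z Uz.
  have [|y By /val_inj <-//] := UB (val z).
  by split=> //; exact: set_mem (valP z).
Qed.

End TraceBarrel.

(** The vector operations come with no continuity, so it is read off the subbase: the translation
    pulls the ball of [rho] at [z] back to the ball at [z + w] of the same radius. *)
Lemma elcs_translation_continuous {R : realType} {k : scalars}
    {X : preTopologicalLmodType (scalar_field R k)} (w : X) :
  elcs X -> continuous (fun x : X => x - w).
Proof.
move=> [_ [P _ [Sop Sb]]] x A /Sb[_ [[D DS <-] Dx] DA].
rewrite nbhs_filterE; apply: filterS (preimage_subset DA) _.
rewrite preimage_bigcap; apply: filter_bigI => U UD.
have [rho [z [e [Prho e0 UE]]]] := set_mem (DS _ UD).
apply: open_nbhs_nbhs; split; last exact: Dx.
apply: Sop; apply: finI_from1; exists rho, (z + w), e; split => //.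
by rewrite UE; apply/seteqP; split=> y /=; rewrite opprD addrA addrAC.
Qed.

(** * Passing between [M] and its finite part *)

Section FinPart.
Context {R : realType} {k : scalars}.
Context {X : preTopologicalLmodType (scalar_field R k)}.
Implicit Types (M B : set X) (rho : X -> \bar R).

Lemma modulus0 : modulus (0 : scalar_field R k) = 0.
Proof. by case: k; rewrite /modulus normr0. Qed.

Lemma fin_part_subspace M rho : linear_subspace M -> extended_seminorm rho ->
  linear_subspace (M `&` fin_part rho).
Proof.
move=> /submod_closed_setP[M0 MD] [rho0 rhoZ rhoD].
apply/submod_closed_setP; split.
  (* Homogeneity at the scalar [0] gives [rho 0 = 0], by the convention on [0 * +oo]. *)
  by split=> //=; rewrite /fin_part /= -(scale0r 0) rhoZ modulus0 mul0e.
move=> a x y [Mx rx] [My ry]; split; first exact: MD.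
rewrite /fin_part/=; apply: le_lt_trans (rhoD _ _) _.
rewrite lte_add_pinfty// rhoZ.
have : rho x \is a fin_num by rewrite ge0_fin_numE.
by move=> /fineK <-; rewrite -EFinM ltry.
Qed.

Lemma barreled_fin_part M rho : elcs X -> linear_subspace M ->
  continuous_extended_seminorm rho ->
  barreled_subspace M -> barreled_subspace (M `&` fin_part rho).
Proof.
move=> elcsX linM [srho crho].
have linN := fin_part_subspace _ _ linM srho.
set N := M `&` fin_part rho in linN *.
have [W [linW WM NW NWM]] := exists_complement _ _ linM linN.
move=> /(barreled_subspaceP _ linM) barM.
apply/(barreled_subspaceP _ linN) => B [[C cC BE] [balB cvxB] absB].
have BN : B `<=` N by rewrite BE => x [].
pose B' : set X := [set x | exists2 w, W w & B (x - w)].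
have B'N x : N x -> B' x -> B x.
  (* Here [w = x - (x - w)] is a difference of two points of [N], so it lies in [N] and [W] at
     once. *)
  move=> Nx [w Ww Bxw]; have w0 : w = 0.
    by apply: NW; split=> //; rewrite -(subKr x w);
      apply: submod_closed_setB => //; exact: BN.
  by move: Bxw; rewrite w0 subr0.
have [|U U0 UB'] := barM B'; last first.
  by exists U => // x [Nx Ux]; apply: B'N => //; apply: UB'; split=> //; case: Nx.
have B'M : B' `<=` M.
  move=> x [w Ww /BN[Mxw _]]; rewrite -(subrK w x).
  by apply: submod_closed_setD => //; exact: WM.
split.
- exists (closure B'); first exact: closed_closure.
  apply/seteqP; split=> [x B'x|x [Mx clx]].
    by split; [exact: B'M|exact: subset_closure].
  have [w Ww Nxw] := NWM x Mx; exists w => //.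
  rewrite BE; split=> //; apply: cC => A nA.
  (* The bound on [rho (y - x)] keeps [y] in the coset [x + N = w + N]; the value [1] could be any
     positive real. *)
  have nx : nbhs x [set y | A (y - w) /\ (rho (y - x)%R < 1%:E)%E].
    apply: filterI; first exact: elcs_translation_continuous.
    apply: (elcs_translation_continuous x elcsX x [set y | (rho y < 1%:E)%E]).
    by rewrite /= subrr; exact: crho.
  have [y [/[dup] B'y [v Wv Byv] [Ayw ryx]]] := clx _ nx.
  have Nyw : N (y - w).
    rewrite -(subrK x y) -addrA; apply: submod_closed_setD => //.
    split; first by apply: submod_closed_setB => //; exact: B'M.
    exact: lt_trans ryx (ltry _).
  (* Both [y - v] and [y - w] lie in [N], so the [W]-components [v] and [w] agree and [y - w] is in
     [B]. *)
  have wv : w - v = 0.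
    apply: NW; split; last exact: submod_closed_setB.
    have -> : w - v = (y - v) - (y - w) by rewrite opprB [RHS]addrC addrA subrK.
    by apply: submod_closed_setB => //; exact: BN.
  exists (y - w); split=> //; move: Byv; rewrite BE => -[_].
  by rewrite (subr0_eq wv).
- split.
  + move=> a a1 _ [x [w Ww Bxw] <-]; exists (a *: w).
      exact: submod_closed_setZ.
    by rewrite -scalerBr; apply: (balB a a1); exists (x - w).
  + move=> x y l /set_mem[v Wv Bxv] /set_mem[w Ww Byw]; apply/mem_set.
    exists (conv l (v : convex_lmodType X) w).
      by apply: (submod_closed_setD _ _ _ linW); exact: submod_closed_setZ.
    have := set_mem (cvxB _ _ l (mem_set Bxv) (mem_set Byw)).
    by rewrite /conv/= !scalerBr addrACA -opprD.
(* The radius that absorbs [x - w] into [B] also works for [x]: the component [w] can be rescaled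
   freely inside [W]. *)
- move=> x /NWM[w Ww Nxw]; have [r r0 rB] := absB _ Nxw.
  exists r => // a ra; have [y By yE] := rB a ra.
  have a0 : a != 0 by rewrite -normr_gt0; exact: lt_le_trans ra.
  exists (y + a^-1 *: w).
    by exists (a^-1 *: w); [exact: submod_closed_setZ|rewrite addrK].
  by rewrite scalerDr scalerA divff// scale1r yE subrK.
Qed.

Lemma barreled_of_fin_part M rho : linear_subspace M ->
  continuous_extended_seminorm rho ->
  barreled_subspace (M `&` fin_part rho) -> barreled_subspace M.
Proof.
move=> linM [srho crho].
have linN := fin_part_subspace _ _ linM srho.
move=> /(barreled_subspaceP _ linN) barN.
apply/(barreled_subspaceP _ linM) => B [[C cC BE] [balB cvxB] absB].
have BM : B `<=` M by rewrite BE => x [].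
have [|U U0 UB] := barN (B `&` fin_part rho); last first.
  (* The ball of [rho] forces points of [M] into the finite part, where [U] is known to land in
     [B]. *)
  exists (U `&` [set x | (rho x < 1%:E)%E]); first exact: filterI (crho _ ltr01).
  move=> x [Mx [Ux rx]]; have rfin : fin_part rho x by apply: lt_trans rx (ltry _).
  by case: (UB x).
split.
- by exists C => //; rewrite BE setIAC.
- split.
  + move=> a a1 _ [x [Bx rx] <-]; split; first by apply: balB a1 _ _; exists x.
    by have [] := submod_closed_setZ _ a _ linN (conj (BM _ Bx) rx).
  + move=> x y l /set_mem[Bx rx] /set_mem[By ry]; apply/mem_set; split.
      exact: (set_mem (cvxB _ _ l (mem_set Bx) (mem_set By))).
    have lx := submod_closed_setZ _ l%:num _ linN (conj (BM _ Bx) rx).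
    have ly := submod_closed_setZ _ (1 - l%:num) _ linN (conj (BM _ By) ry).
    by have [] := submod_closed_setD _ _ _ linN lx ly.
- move=> x [Mx rx]; have [r r0 rB] := absB _ Mx.
  exists r => // a ra; have [y By yE] := rB a ra.
  have a0 : a != 0 by rewrite -normr_gt0; exact: lt_le_trans ra.
  exists y => //; split=> //.
  (* The point of [B] that absorbs [x] is a multiple of [x], so it stays in the finite part. *)
  have -> : y = a^-1 *: x by rewrite -yE scalerA mulVf// scale1r.
  by have [] := submod_closed_setZ _ a^-1 _ linN (conj Mx rx).
Qed.

(** The witness that makes the existential statement follow from the universal one. *)
Lemma continuous_seminorm0 :
  continuous_extended_seminorm (fun _ : X => 0 : \bar R).
Proof.
split; first by split=> *; rewrite ?mule0 ?adde0.
by move=> e e0; apply: filterS filterT => x _ /=; rewrite lte_fin.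
Qed.

End FinPart.

Theorem theorem3p9 (R : realType) (k : scalars)
    (X : preTopologicalLmodType (scalar_field R k)) (elcsX : elcs X)
    (M : set X) (linM : linear_subspace M) :
  [<-> barreled_subspace M;
       forall rho : X -> \bar R, continuous_extended_seminorm rho ->
         barreled_subspace (M `&` fin_part rho);
       exists2 rho : X -> \bar R, continuous_extended_seminorm rho &
         barreled_subspace (M `&` fin_part rho)].
Proof.
tfae.
- by move=> barM rho crho; exact: barreled_fin_part.
- by move=> barN; exists (fun=> 0%E); [|apply: barN];
    exact: continuous_seminorm0.
- by move=> [rho crho barN]; exact: barreled_of_fin_part barN.
Qed.
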